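(* If an irreducible semigroup $\mathcal S$ of real $d\times d$ matrices has constant spectral radius, then there is a basis of $\mathbb R^d$ in which all nonsingular elements of $\mathcal S$ are orthogonal matrices, i.e. there is an invertible real $d\times d$ matrix $T$ such that $T^{-1}AT\in O(d)$ for every nonsingular $A\in\mathcal S$.
   Context: Matrix semigroups are multiplicative; the paper considers topologically closed semigroups. The spectral radius $\rho(A)$ is the maximal modulus of the eigenvalues of $A$. A matrix semigroup has constant spectral radius (is c.s.r.) if the spectral radius of all its elements is the same and nonzero. A family of $d\times d$ matrices is irreducible if there is no proper linear subspace of $\mathbb R^d$ (different from $\{0\}$ and $\mathbb R^d$) invariant for all matrices of the family. $O(d)$ is the orthogonal group. *)

(* Defs.v *)
From mathcomp Require Import all_boot all_order all_algebra.
From mathcomp Require Import all_classical all_reals all_analysis.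
From mathcomp Require Import complex.

Set Implicit Arguments.
Unset Strict Implicit.
Unset Printing Implicit Defensive.

Import Order.TTheory GRing.Theory Num.Theory.
Import numFieldNormedType.Exports.

Local Open Scope classical_set_scope.
Local Open Scope ring_scope.

(* The complex eigenvalues of the real matrix A. MathComp's eigenvalue refers to
   row eigenvectors, which for a square matrix yields the same eigenvalues as
   column eigenvectors. *)
Definition complex_spectrum (R : realType) (d : nat) (A : 'M[R]_d) : set R[i] :=
  [set z | eigenvalue (map_mx (real_complex R) A) z].

(* For d > 0 the spectrum is finite and nonempty, so this sup is a maximum;
   for d = 0 the spectrum is empty and the value is 0. The modulus
   ComplexField.Normc.normc is the R-valued one, whereas `|z| lives in R[i]. *)
Definition spectral_radius (R : realType) (d : nat) (A : 'M[R]_d) : R :=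
  sup [set ComplexField.Normc.normc z | z in complex_spectrum A].

Definition matrix_semigroup (R : realType) (d : nat) (S : set 'M[R]_d) : Prop :=
  forall A B : 'M[R]_d, S A -> S B -> S (A *m B).

Definition constant_spectral_radius (R : realType) (d : nat)
    (S : set 'M[R]_d) : Prop :=
  exists2 r : R, r != 0 & forall A : 'M[R]_d, S A -> spectral_radius A = r.

(* Matrices act on R^d by left multiplication on column vectors. *)
Definition invariant_subspace (R : realType) (d : nat) (S : set 'M[R]_d)
    (V : {vspace 'cV[R]_d}) : Prop :=
  forall (A : 'M[R]_d) (v : 'cV[R]_d), S A -> v \in V -> A *m v \in V.

Definition irreducible_family (R : realType) (d : nat)
    (S : set 'M[R]_d) : Prop :=
  forall V : {vspace 'cV[R]_d},
    invariant_subspace S V -> V = 0%VS \/ V = fullv.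

Definition orthogonal_group (R : realType) (d : nat) : set 'M[R]_d :=
  [set Q | Q^T *m Q = 1%:M].

(* Main.v *)
(* Eigenvalues of powers are powers of eigenvalues, so all eigenvalues of
   elements of S have modulus at most 1 and their traces are bounded; the trace
   form is nondegenerate on the algebra spanned by an irreducible S, hence S is
   bounded, and compact.

   Compressing S by an element U V of minimal (nonzero) rank r gives a bounded
   semigroup of invertible r x r matrices V B U with |det| >= 1.  The positive
   semidefinite form of largest determinant in a compact convex set of forms is
   unique, so this semigroup preserves a positive definite form; pulling it back
   along V gives a form p on R^d and a vector e with p(B e) = 1 for all B in S.

   Finally consider the compact convex set C of the positive semidefinite forms
   equal to 1 on S e.  It is stable under q |-> M^T q M for M in S, and under
   M^-1 as well when M is nonsingular, so M has |det M| >= 1 and fixes the form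
   of largest determinant in C; a basis orthonormal for it is the required one. *)

Require Import Defs.
From mathcomp Require Import all_boot all_order all_algebra.
From mathcomp Require Import all_classical all_reals all_analysis.
From mathcomp Require Import complex.
From mathcomp Require Import ring lra.

Set Implicit Arguments.
Unset Strict Implicit.
Unset Printing Implicit Defensive.

Import Order.TTheory GRing.Theory Num.Theory.
Import numFieldNormedType.Exports.

Local Open Scope classical_set_scope.
Local Open Scope ring_scope.

(** * Quadratic forms *)

Definition qform (R : pzRingType) n (q : 'M[R]_n) (x : 'cV[R]_n) : R :=
  (x^T *m q *m x) 0 0.

Definition psd (R : numDomainType) n (q : 'M[R]_n) : Prop :=
  q^T = q /\ forall x, 0 <= qform q x.

Definition pd (R : numDomainType) n (q : 'M[R]_n) : Prop :=
  q^T = q /\ forall x, x != 0 -> 0 < qform q x.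

Section QuadraticForms.
Variable R : rcfType.

Lemma qform_congr m n (q : 'M[R]_m) (M : 'M[R]_(m, n)) x :
  qform (M^T *m q *m M) x = qform q (M *m x).
Proof. by rewrite /qform trmx_mul !mulmxA. Qed.

Lemma qform_tr n (q : 'M[R]_n) x : qform q x = \tr (q *m (x *m x^T)).
Proof.
by rewrite /qform mulmxA mxtrace_mulC mulmxA /mxtrace big_ord1.
Qed.

Lemma qformDl n (p q : 'M[R]_n) x : qform (p + q) x = qform p x + qform q x.
Proof. by rewrite /qform mulmxDr mulmxDl mxE. Qed.

Lemma qformZl n c (q : 'M[R]_n) x : qform (c *: q) x = c * qform q x.
Proof. by rewrite /qform -scalemxAr -scalemxAl mxE. Qed.

Lemma qformZr n c (q : 'M[R]_n) x : qform q (c *: x) = c ^+ 2 * qform q x.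
Proof.
by rewrite /qform -!scalemxAr linearZ /= -!scalemxAl scalerA mxE.
Qed.

Lemma qform1 n (x : 'cV[R]_n) : qform 1%:M x = \sum_i x i 0 ^+ 2.
Proof.
rewrite /qform mulmx1 mxE; apply: eq_bigr => i _.
by rewrite mxE expr2.
Qed.

Lemma qform1_ge0 n (x : 'cV[R]_n) : 0 <= qform 1%:M x.
Proof. by rewrite qform1 sumr_ge0 // => i _; rewrite sqr_ge0. Qed.

Lemma qform1_eq0 n (x : 'cV[R]_n) : (qform 1%:M x == 0) = (x == 0).
Proof.
rewrite qform1 psumr_eq0; last by move=> i _; exact: sqr_ge0.
apply/allP/eqP => [h|-> i _]; last by rewrite mxE expr0n /= eqxx.
apply/colP => i; rewrite mxE; apply/eqP; rewrite -sqrf_eq0.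
by apply: h; rewrite mem_index_enum.
Qed.

Lemma qformDr n (q : 'M[R]_n) x y : q^T = q ->
  qform q (x + y) = qform q x + qform q y + 2 * (x^T *m q *m y) 0 0.
Proof.
move=> sq.
have e : (y^T *m q *m x) 0 0 = (x^T *m q *m y) 0 0.
  by rewrite -[RHS]trace_mx11 -mxtrace_tr trace_mx11 !trmx_mul trmxK sq mulmxA.
rewrite /qform mulmxDr linearD /= !mulmxDl !mxE.
have := e; rewrite !mxE => ->; ring.
Qed.

(** For every [t], [0 <= qform q (t *: x + q *m x) = qform q (q *m x) + 2 t b], where [b] is the
    squared Euclidean norm of [q *m x]. An affine function of [t] bounded below is constant, so
    [b = 0]; the [t] chosen for [b != 0] would give the value -1. *)
Lemma psd_ker n (q : 'M[R]_n) x : psd q -> qform q x = 0 -> q *m x = 0.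
Proof.
move=> [sq q0] qx; apply/eqP; rewrite -qform1_eq0; apply/eqP.
set b := qform _ _.
have eb : (x^T *m q *m (q *m x)) 0 0 = b.
  by rewrite /b /qform mulmx1 trmx_mul sq.
have h t : 0 <= qform q (q *m x) + 2 * t * b.
  apply: le_trans (q0 (t *: x + q *m x)) _.
  by rewrite qformDr // qformZr qx linearZ /= -!scalemxAl mxE eb; lra.
apply/eqP/contraT => b0.
have := h (- (qform q (q *m x) + 1) / 2 / b).
rewrite [X in _ + X](_ : _ = - (qform q (q *m x) + 1)); last by field.
lra.
Qed.

Lemma pd_psd n (q : 'M[R]_n) : pd q -> psd q.
Proof.
move=> [sq q0]; split=> // x; have [->|/q0/ltW//] := eqVneq x 0.
by rewrite /qform mulmx0 mxE.
Qed.

Lemma psd_unit_pd n (q : 'M[R]_n) : psd q -> q \in unitmx -> pd q.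
Proof.
move=> pq uq; case: (pq) => sq q0; split=> // x x0.
rewrite lt_neqAle q0 andbT eq_sym; apply: contra x0 => /eqP /(psd_ker pq) h.
by rewrite -(mulKmx uq x) h mulmx0.
Qed.

Lemma psd_congr m n (q : 'M[R]_m) (M : 'M[R]_(m, n)) :
  psd q -> psd (M^T *m q *m M).
Proof.
move=> [sq q0]; split=> [|x]; last by rewrite qform_congr.
by rewrite !trmx_mul trmxK sq mulmxA.
Qed.

Lemma psdD n (p q : 'M[R]_n) : psd p -> psd q -> psd (p + q).
Proof.
move=> [sp p0] [sq q0]; split=> [|x]; last by rewrite qformDl addr_ge0.
by rewrite linearD /= sp sq.
Qed.

Lemma psdZ n c (q : 'M[R]_n) : 0 <= c -> psd q -> psd (c *: q).
Proof.
move=> c0 [sq q0]; split=> [|x]; last by rewrite qformZl mulr_ge0.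
by rewrite linearZ /= sq.
Qed.

Lemma pd1 n : pd (1%:M : 'M[R]_n).
Proof.
split=> [|x x0]; first by rewrite trmx1.
by rewrite lt_neqAle eq_sym qform1_eq0 x0 qform1_ge0.
Qed.

(** Induction on the dimension: the block shear [L] clears the first row and column off the
    diagonal, leaving the corner [a] and its Schur complement [s], which is again positive definite.
    The corner is then normalized by [1 / sqrt a]. *)
Lemma pd_cholesky n (q : 'M[R]_n) : pd q ->
  exists2 T : 'M[R]_n, T \in unitmx & T^T *m q *m T = 1%:M.
Proof.
elim: n q => [|n IHn] q.
  by exists 1%:M; [exact: unitmx1 | apply/matrixP => -[]].
rewrite -[n.+1]/(1 + n)%N in q *; move=> [sq q0].
pose a := q 0 0.
have ea : ulsubmx q = a%:M.
  apply/matrixP => i j; rewrite !mxE !ord1 eqxx mulr1n /a; congr (q _ _); exact: val_inj.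
pose b := ursubmx q; pose c := drsubmx q.
have eb : dlsubmx q = b^T by rewrite /b trmx_ursub sq.
have sc : c^T = c by rewrite /c trmx_drsub sq.
have eq : q = block_mx a%:M b b^T c by rewrite -[LHS]submxK ea eb.
have a0 : 0 < a.
  have := q0 (delta_mx 0 0); rewrite /qform trmx_delta -rowE -colE !mxE; apply.
  by apply/eqP => /matrixP/(_ 0 0)/eqP; rewrite !mxE /= oner_eq0.
have an0 : a != 0 by rewrite gt_eqF.
pose s := c - a^-1 *: (b^T *m b).
pose L : 'M[R]_(1 + n) := block_mx 1%:M (- a^-1 *: b) 0 1%:M.
have eL : L^T *m q *m L = block_mx a%:M 0 0 s.
  rewrite /L tr_block_mx eq !mulmx_block !trmx1 !trmx0 !(mul1mx, mulmx1, mul0mx, mulmx0, addr0, add0r).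
  have eN : (- a^-1 *: b)^T = - a^-1 *: b^T by rewrite linearZ.
  rewrite eN mul_scalar_mx mul_mx_scalar !scalerA mulrN divff // !scaleN1r !addNr.
  by rewrite mul0mx add0r -scalemxAl addrC scaleNr.
have uL : L \in unitmx by rewrite unitmxE det_ublock !det1 mulr1 unitr1.
have ps : pd s.
  split=> [|y y0].
    by rewrite /s linearB /= linearZ /= trmx_mul trmxK sc.
  have := q0 (L *m col_mx 0 y); rewrite -qform_congr eL /qform.
  rewrite tr_col_mx mul_row_block mul_row_col !(trmx0, mulmx0, mul0mx, addr0, add0r).
  apply; apply: contra y0 => /eqP h.
  have : col_mx 0 y = 0 :> 'cV[R]_(1 + n) by rewrite -(mulKmx uL (col_mx 0 y)) h mulmx0.
  by rewrite -[0 in RHS]col_mx0 => /eq_col_mx [_ ->].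
have [T uT eT] := IHn _ ps.
exists (L *m block_mx (Num.sqrt a)^-1%:M 0 0 T).
  rewrite unitmx_mul uL unitmxE det_ublock det_scalar1 unitrM -!unitmxE uT andbT.
  by rewrite unitfE invr_eq0 sqrtr_eq0 -ltNge.
rewrite trmx_mul -!mulmxA [L^T *m _]mulmxA [L^T *m q *m _]mulmxA eL.
rewrite tr_block_mx !mulmx_block !trmx0 !(mulmx0, mul0mx, addr0, add0r) tr_scalar_mx.
rewrite -!scalar_mxM mulmxA eT.
rewrite [X in X%:M](_ : _ = 1).
  by rewrite -scalar_mx_block.
have : Num.sqrt a != 0 by rewrite sqrtr_eq0 -ltNge.
by move: (sqr_sqrtr (ltW a0)); move: (Num.sqrt a) => t <- t0; field.
Qed.

Lemma pd_det_gt0 n (q : 'M[R]_n) : pd q -> 0 < \det q.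
Proof.
move=> /pd_cholesky [T uT /(congr1 determinant)].
rewrite !det_mulmx det_tr det1 => h.
have t0 : \det T != 0 by rewrite -unitfE -unitmxE.
have : 0 < \det T ^+ 2 * \det q by rewrite expr2 mulrAC h.
by rewrite pmulr_rgt0 // exprn_even_gt0.
Qed.
End QuadraticForms.

(** * Equality case of the midpoint determinant inequality *)

Section DetConcave.
Variable R : rcfType.

(** Write the row eigenvector as [a + i b] and [z] as [x + i y]. Symmetry gives [a q b^T = b q a^T],
    which becomes [y (|a|^2 + |b|^2) = 0]; once [y = 0], the values of [q] at [a] and [b] are
    [x |a|^2] and [x |b|^2], so [x >= 0]. *)
Lemma psd_eigenvalue n (q : 'M[R]_n) z : psd q ->
  eigenvalue (map_mx (real_complex R) q) z -> exists2 t : R, 0 <= t & z = t%:C%C.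
Proof.
move=> [sq q0] /eigenvalueP [v ev v0]; case: z ev => x y ev.
pose a := map_mx (@complex.Re R) v; pose b := map_mx (@complex.Im R) v.
have e1 : a *m q = x *: a - y *: b.
  apply/rowP => j; move/rowP: ev => /(_ j) /(congr1 (@complex.Re R)).
  rewrite !mxE raddf_sum /=; under eq_bigr do rewrite !mxE.
  have -> : complex.Re ((x +i* y)%C * v 0 j) = x * complex.Re (v 0 j) - y * complex.Im (v 0 j).
    by case: (v 0 j).
  move=> <-; apply: eq_bigr => i _; rewrite !mxE.
  by case: (v 0 i) => /= s t; rewrite mulr0 subr0.
have e2 : b *m q = y *: a + x *: b.
  apply/rowP => j; move/rowP: ev => /(_ j) /(congr1 (@complex.Im R)).
  rewrite !mxE raddf_sum /=; under eq_bigr do rewrite !mxE.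
  have -> : complex.Im ((x +i* y)%C * v 0 j) = y * complex.Re (v 0 j) + x * complex.Im (v 0 j).
    by case: (v 0 j) => s t /=; rewrite addrC.
  move=> <-; apply: eq_bigr => i _; rewrite !mxE.
  by case: (v 0 i) => /= s t; rewrite mulr0 add0r.
pose na := \tr (a *m a^T); pose nb := \tr (b *m b^T).
have na_qform : na = qform 1%:M a^T by rewrite /qform trmxK mulmx1 -trace_mx11.
have nb_qform : nb = qform 1%:M b^T by rewrite /qform trmxK mulmx1 -trace_mx11.
have na0 : 0 <= na by rewrite na_qform qform1_ge0.
have nb0 : 0 <= nb by rewrite nb_qform qform1_ge0.
have ab : \tr (a *m b^T) = \tr (b *m a^T) by rewrite -mxtrace_tr trmx_mul trmxK.
have aqb : \tr (a *m q *m b^T) = \tr (b *m q *m a^T).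
  by rewrite -mxtrace_tr !trmx_mul trmxK sq mulmxA.
have nab : 0 < na + nb.
  rewrite lt_neqAle addr_ge0 // andbT eq_sym; apply: contra v0.
  rewrite paddr_eq0 //.
  rewrite na_qform nb_qform !qform1_eq0.
  move=> /andP [/eqP /colP ha /eqP /colP hb]; apply/eqP/rowP => j.
  by move: (ha j) (hb j); rewrite !mxE; case: (v 0 j) => /= s t -> ->.
move: aqb; rewrite e1 e2 mulmxBl mulmxDl -!scalemxAl raddfB raddfD /= !mxtraceZ.
rewrite -/na -/nb ab => aqb.
have y0 : y = 0.
  have /eqP : y * (na + nb) = 0 by lra.
  by rewrite mulf_eq0 (gt_eqF nab) orbF => /eqP.
exists x; last by rewrite y0.
have ha : 0 <= x * na.
  by have := q0 a^T; rewrite /qform trmxK e1 y0 scale0r subr0 -trace_mx11 -scalemxAl mxtraceZ.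
have hb : 0 <= x * nb.
  by have := q0 b^T; rewrite /qform trmxK e2 y0 scale0r add0r -trace_mx11 -scalemxAl mxtraceZ.
by rewrite -(pmulr_lge0 _ nab) mulrDr addr_ge0.
Qed.

(* After diagonalization det q = \prod t_i and
   det ((1 + q) / 2) = \prod (1 + t_i) / 2, so AM-GM is strict unless q = 1. *)
Lemma psd_det_mid1 n (q : 'M[R]_n) : psd q -> \det q = 1 ->
  \det (2^-1 *: (1%:M + q)) <= 1 -> q = 1%:M.
Proof.
move=> pq dq dm; have [sq q0] := pq.
pose A := map_mx (real_complex R) q.
have sA : A \is symmetricmx.
  by apply/is_hermitianmxP; rewrite expr0 scale1r map_mx_id //; apply/matrixP => i j; rewrite !mxE -{1}sq mxE.
have rA : A \is a mxOver Num.real.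
  by apply/mxOverP => i j; rewrite mxE complex_real.
have /orthomx_spectralP := symmetric_normalmx sA rA.
set P := spectralmx A; set D := spectral_diag A => eA.
have uP : P \in unitmx by exact: spectral_unit.
have hD i : exists2 t : R, 0 <= t & D 0 i = t%:C%C.
  apply: (psd_eigenvalue pq); apply/eigenvalueP; exists (row i P).
    rewrite -/A -row_mul eA -mulmxA mulKVmx // row_mul row_diag_mx -scalemxAl.
    by rewrite -rowE.
  apply/eqP => h; have := mulmxV uP => /(congr1 (row i)).
  rewrite row_mul h mul0mx => /rowP/(_ i)/eqP.
  by rewrite !mxE eqxx eq_sym oner_eq0.
have {hD} [t ht] : exists t : 'I_n -> R, forall i, 0 <= t i /\ D 0 i = (t i)%:C%C.
  suff /choice [t ht] : forall i, exists t : R, 0 <= t /\ D 0 i = t%:C%C by exists t.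
  by move=> i; have [t t0 ht] := hD i; exists t.
have t0 i : 0 <= t i by case: (ht i).
have Dt i : D 0 i = (t i)%:C%C by case: (ht i).
have det_conj (E : 'M[R[i]]_n) : \det (invmx P *m E *m P) = \det E.
  by rewrite !det_mulmx mulrC mulrA -det_mulmx mulmxV // det1 mul1r.
have p1 : \prod_i t i = 1.
  apply: (@complexI R); rewrite rmorph_prod -dq.
  rewrite -det_map_mx -/A eA det_conj det_diag; apply: eq_bigr => i _; by rewrite Dt.
have pm : \prod_i (2^-1 * (1 + t i)) <= 1.
  rewrite (_ : \prod_i _ = \det (2^-1 *: (1%:M + q))) //.
  apply: (@complexI R); rewrite rmorph_prod -det_map_mx map_mxZ map_mxD map_mx1 -/A.
  rewrite -(mulVmx uP) -(mulmx1 (invmx P)) [in RHS]eA -mulmxDl -mulmxDr scalemxAl scalemxAr det_conj.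
  rewrite -diag_const_mx -linearD -linearZ /= det_diag; apply: eq_bigr => i _.
  by rewrite !mxE Dt rmorphM rmorphD rmorph1.
have t1 i : t i = 1.
  apply/eqP/contraT => ti.
  (* Squaring the means avoids roots in AM-GM: [f j - t j = ((t j - 1) / 2) ^ 2]. The product of the
     [f j] is at most 1 by [pm], while that of the [t j] is 1, so no inequality can be strict. *)
  pose f j := (2^-1 * (1 + t j)) ^+ 2.
  have tf j : t j <= f j.
    by have := sqr_ge0 (t j - 1); rewrite /f !expr2; lra.
  have tfi : t i < f i.
    have : 0 < (t i - 1) ^+ 2 by rewrite exprn_even_gt0 //= subr_eq0.
    by rewrite /f !expr2; lra.
  have := p1; rewrite (bigD1 i) //= => p1'.
  have : \prod_j f j <= 1.
    by rewrite prodrXl expr_le1 // prodr_ge0 // => j _; rewrite mulr_ge0 ?invr_ge0 // addr_ge0.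
  rewrite (bigD1 i) //= leNgt -[X in X < _]p1' => /negP [].
  have pr0 : 0 < \prod_(j < n | j != i) t j.
    rewrite lt_neqAle prodr_ge0 // andbT eq_sym.
    by apply/eqP => h; move: p1'; rewrite h mulr0 => /eqP; rewrite eq_sym oner_eq0.
  apply: (@lt_le_trans _ _ (f i * \prod_(j < n | j != i) t j)); first by rewrite ltr_pM2r.
  rewrite ler_pM2l ?(le_lt_trans (t0 i)) //; apply: ler_prod => j _; by rewrite t0 tf.
suff : A = 1%:M.
  move=> /matrixP h; apply/matrixP => i j; apply: (@complexI R).
  by have := h i j; rewrite !mxE => ->; rewrite rmorph_nat.
rewrite eA (_ : D = const_mx 1); last by apply/rowP => i; rewrite Dt t1 mxE.
by rewrite diag_const_mx mulmx1 mulVmx.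
Qed.
End DetConcave.
(** * Compact sets of matrices *)

Section MatrixTopology.
Variable R : realType.

Lemma mx_continuous (T : topologicalType) m n (f : T -> 'M[R]_(m, n)) :
  (forall i j, continuous (fun x => f x i j)) -> continuous f.
Proof.
move=> cf x A [P MP sPA].
have : \forall y \near x, forall i j, P i j (f y i j).
  by apply: filter_forall => i; apply: filter_forall => j; exact: (cf i j x).
by apply: filterS => y Py; apply: sPA.
Qed.

Lemma continuous_mulr (T : topologicalType) (f g : T -> R) :
  continuous f -> continuous g -> continuous (fun x => f x * g x).
Proof. by move=> cf cg x; exact: continuousM (cf x) (cg x). Qed.

Lemma mulmx_continuous m n p q (A : 'M[R]_(m, n)) (B : 'M[R]_(p, q)) :
  continuous (fun M : 'M[R]_(n, p) => A *m M *m B).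
Proof.
apply: mx_continuous => i j.
rewrite (_ : (fun _ => _) = fun M : 'M[R]_(n, p) => \sum_k \sum_l (A i l * M l k) * B k j); last first.
  by apply/funext => M; rewrite mxE; apply: eq_bigr => k _; rewrite mxE mulr_suml.
apply: continuous_big => [|k _]; first exact: add_continuous.
apply: continuous_big => [|l _]; first exact: add_continuous.
apply: continuous_mulr; last by exact: cst_continuous.
by apply: continuous_mulr; [exact: cst_continuous|exact: coord_continuous].
Qed.

Lemma determinant_continuous n : continuous (fun M : 'M[R]_n => \det M).
Proof.
apply: continuous_big => [|s _]; first exact: add_continuous.
apply: continuous_mulr; first by exact: cst_continuous.
apply: continuous_big => [|i _]; first exact: mul_continuous.
exact: coord_continuous.
Qed.

Lemma closed_preimage (T : topologicalType) (f : T -> R) (A : set R) :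
  continuous f -> closed A -> closed (f @^-1` A).
Proof. by move=> cf cA; apply: preimage_closed => // x _; exact: cf. Qed.

(** Heine-Borel is applied to row vectors of length [m * n], and the continuous map [vec_mx] carries
    compactness over to matrices. *)
Lemma mx_compact m n (A : set 'M[R]_(m, n)) K :
  (forall M i j, A M -> `|M i j| <= K) -> closed A -> compact A.
Proof.
move=> bA cA.
have cv : continuous (@vec_mx R m n).
  apply: mx_continuous => i j; rewrite (_ : (fun _ => _) = fun v : 'rV[R]_(m * n) => v 0 (mxvec_index i j)).
    exact: coord_continuous.
  by apply/funext => v; rewrite mxE.
have -> : A = vec_mx @` (vec_mx @^-1` A).
  apply/seteqP; split=> [M AM|_ [v + <-]//].
  by exists (mxvec M) => /=; rewrite mxvecK.
apply: continuous_compact; first by apply: continuous_subspaceT.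
apply: bounded_closed_compact; last by apply: preimage_closed.
(* The absolute value matters: [K] may be negative when [A] is empty or its matrices have no
   entries. *)
exists `|K|; split; first exact: num_real.
move=> x Kx v Av; change (`|v| <= x).
rewrite [leLHS]/Num.Def.normr /= mx_normrE; apply/bigmax_leP; split=> [|[i j] _] /=.
  exact: le_trans (ltW Kx).
rewrite (ord1 i); case/mxvec_indexP: j => k l.
have := bA _ k l Av; rewrite mxE => /le_trans; apply.
exact: le_trans (ler_norm _) (ltW Kx).
Qed.

(** * Compact sets of semidefinite forms and their determinant maximizers *)

Lemma qform_continuous n (x : 'cV[R]_n) : continuous (fun q : 'M[R]_n => qform q x).
Proof.
move=> q; apply: (@continuous_comp _ _ _ (fun q => x^T *m q *m x) (fun y => y 0 0)).
  exact: mulmx_continuous.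
exact: coord_continuous.
Qed.

Lemma psd_closed n : closed [set q : 'M[R]_n | psd q].
Proof.
rewrite (_ : [set _ | _] =
  (\bigcap_i \bigcap_j [set q : 'M[R]_n | q i j - q j i = 0]) `&`
  \bigcap_x [set q : 'M[R]_n | 0 <= qform q x]).
  apply: closedI; apply: closed_bigI => i _.
    apply: closed_bigI => j _.
    apply: (@closed_preimage _ _ [set y | y = 0]); last exact: closed_eq.
    by move=> q; apply: (@continuousB _ _ _ (fun q : 'M[R]_n => q i j) (fun q => q j i)); exact: coord_continuous.
  apply: (@closed_preimage _ _ [set y | 0 <= y]); last exact: closed_ge.
  exact: qform_continuous.
apply/seteqP; split=> [q [sq q0]|q [sq q0]] /=.
  split=> [i _ j _|x _] /=; last exact: q0.
  by rewrite -{1}sq mxE subrr.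
split=> [|x]; last exact: q0.
by apply/matrixP => i j; rewrite mxE; apply/eqP; rewrite -subr_eq0; apply/eqP/sq.
Qed.

(** Nonnegativity of [q] at [e_i + e_j] and at [e_i - e_j] bounds [2 |q i j|] by [q i i + q j j]. *)
Lemma psd_entry n (q : 'M[R]_n) i j b : psd q ->
  (forall k, qform q (delta_mx k 0) <= b) -> `|q i j| <= b.
Proof.
move=> [sq q0] hb.
have qd k l : ((delta_mx k 0 : 'cV[R]_n)^T *m q *m (delta_mx l 0 : 'cV_n)) 0 0 = q k l.
  by rewrite trmx_delta -rowE -colE !mxE.
have h1 := q0 (delta_mx i 0 + delta_mx j 0).
have h2 := q0 (delta_mx i 0 + -1 *: delta_mx j 0).
rewrite qformDr // qd in h1.
rewrite qformDr // qformZr -scalemxAr mxE qd in h2.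
have := hb i; have := hb j; rewrite ler_norml expr2 in h2 *.
by move=> ? ?; apply/andP; split; lra.
Qed.

Lemma psd_compact n (C : set 'M[R]_n) : closed C -> (forall q, C q -> psd q) ->
  (forall i, exists b, forall q, C q -> qform q (delta_mx i 0) <= b) -> compact C.
Proof.
move=> clC psdC /choice [b hb].
apply: (@mx_compact _ _ _ (\sum_i `|b i|)) => // q i j Cq.
apply: psd_entry; first exact: psdC.
move=> k; apply: le_trans (hb k q Cq) _; apply: le_trans (ler_norm _) _.
by rewrite (bigD1 k) //= lerDl sumr_ge0.
Qed.

(** A congruence by [T] with [T^T p T = 1] multiplies all determinants by the same factor
    [\det T ^+ 2], which reduces the claim to [p = 1]. *)
Lemma psd_det_mid n (p q : 'M[R]_n) : pd p -> psd q -> \det q = \det p ->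
  \det (2^-1 *: (p + q)) <= \det p -> q = p.
Proof.
move=> pdp psdq dpq dm; have [T uT eT] := pd_cholesky pdp.
have dT : \det T ^+ 2 * \det p = 1.
  by have := congr1 determinant eT; rewrite !det_mulmx det_tr det1 => <-; rewrite expr2 mulrAC.
suff e : T^T *m q *m T = 1%:M.
  have uTT : T^T \in unitmx by rewrite unitmx_tr.
  by apply: (can_inj (mulKmx uTT)); apply: (can_inj (mulmxK uT)); rewrite e eT.
apply: psd_det_mid1; first exact: psd_congr.
  by rewrite !det_mulmx det_tr dpq mulrAC -expr2.
rewrite -eT -mulmxDl -mulmxDr scalemxAl scalemxAr !det_mulmx det_tr mulrAC -expr2.
by rewrite -[X in _ <= X]dT ler_wpM2l ?sqr_ge0.
Qed.

(** The positive definite member makes the maximum positive, so a maximizer is definite. The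
    midpoint of two maximizers stays in [C], hence has no larger determinant, and [psd_det_mid]
    identifies them. *)
Lemma det_maximizer n (C : set 'M[R]_n) : compact C -> (forall q, C q -> psd q) ->
  (forall p q, C p -> C q -> C (2^-1 *: (p + q))) -> (exists2 p, C p & pd p) ->
  exists q0, [/\ C q0, pd q0, forall q, C q -> \det q <= \det q0 &
    forall q, C q -> \det q0 <= \det q -> q = q0].
Proof.
move=> cC psdC midC [p Cp pdp].
have [||q0] := @compact_EVT_max _ _ (fun q : 'M[R]_n => \det q) C _ cC.
- by exists p.
- by apply: continuous_subspaceT; exact: determinant_continuous.
rewrite inE => Cq0 max.
have {}max q : C q -> \det q <= \det q0 by move=> Cq; apply: max; rewrite inE.
have pd0 : pd q0.
  apply: psd_unit_pd; first exact: psdC.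
  by rewrite unitmxE unitfE gt_eqF // (lt_le_trans (pd_det_gt0 pdp)) // max.
exists q0; split=> // q Cq dq.
apply: psd_det_mid => //; first exact: psdC.
  by apply/le_anti; rewrite max.
by apply: max; exact: midC.
Qed.
End MatrixTopology.
(** * Trace form of an irreducible semigroup *)

Section Span.
Variables (K : fieldType) (V : vectType K).

(** Take a free sequence in [Y] of maximal length, which exists because the dimension bounds the
    length. It serves as a finite spanning family consisting of members of a possibly infinite
    set. *)
Lemma free_family (Y : set V) :
  exists X : seq V, [/\ free X, forall x, x \in X -> Y x & forall y, Y y -> y \in <<X>>%VS].
Proof.
pose P n := `[< exists X : seq V, [/\ free X, forall x, x \in X -> Y x & size X = n] >].
have exP : exists n, P n.
  by exists 0%N; apply/asboolP; exists [::]; split=> //; rewrite nil_free.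
have ubP n : P n -> (n <= \dim {:V})%N.
  move=> /asboolP [X [fX _ <-]]; move: fX; rewrite /free => /eqP <-.
  exact/dimvS/subvf.
case: (ex_maxnP exP ubP) => n /asboolP [X [fX XY sX]] max.
exists X; split=> // y Yy; apply/contraT => yX.
have : P n.+1.
  apply/asboolP; exists (y :: X); split; rewrite ?free_cons ?yX //= ?sX //.
  by move=> x; rewrite inE => /predU1P [->//|/XY].
by move=> /max; rewrite ltnn.
Qed.

Lemma span_ind (P : V -> Prop) (X : seq V) :
  P 0 -> (forall a u v, P u -> P v -> P (a *: u + v)) ->
  (forall x, x \in X -> P x) -> forall v, v \in <<X>>%VS -> P v.
Proof.
move=> P0 PD PX v /(coord_span (X := in_tuple X)) ->.
elim/big_ind : _ => [//|u w Pu Pw|i _]; first by rewrite -[u]scale1r; exact: PD.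
by rewrite -[_ *: _]addr0; apply: PD => //; apply: PX; rewrite mem_nth.
Qed.
End Span.

Section Semigroup.
Variables (R : realType) (d : nat) (S : set 'M[R]_d).
Hypothesis S_semigroup : matrix_semigroup S.
Hypothesis S_irr : irreducible_family S.

(** This form of irreducibility applies to subspaces given by a property, such as a common kernel or
    boundedness of a family of forms; the subspace is recovered as the span of a maximal free family
    satisfying [P]. *)
Lemma irreducible_dichotomy (P : 'cV[R]_d -> Prop) :
  P 0 -> (forall a u v, P u -> P v -> P (a *: u + v)) ->
  (forall A v, S A -> P v -> P (A *m v)) ->
  (forall v, P v -> v = 0) \/ (forall v, P v).
Proof.
move=> P0 PD PS; have [X [_ XP PX]] := free_family P.
have XP' := span_ind P0 PD XP.
have [|V0|VT] := S_irr (V := <<X>>%VS).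
- by move=> A v SA /XP' Pv; apply: PX; exact: PS.
- by left=> v /PX; rewrite V0 memv0 => /eqP.
- by right=> v; apply: XP'; rewrite VT memvf.
Qed.

Lemma span_semigroup_mul (X : seq 'M[R]_d) :
  (forall x, x \in X -> S x) -> (forall y, S y -> y \in <<X>>%VS) ->
  forall a b, a \in <<X>>%VS -> b \in <<X>>%VS -> a *m b \in <<X>>%VS.
Proof.
move=> XS SX a b aX; move: b; apply: span_ind => [|k u v hu hv|x /XS Sx].
- by rewrite mulmx0 mem0v.
- by rewrite mulmxDr -scalemxAr memvD // memvZ.
move: a aX; apply: span_ind => [|k u v hu hv|y /XS Sy].
- by rewrite mul0mx mem0v.
- by rewrite mulmxDl -scalemxAl memvD // memvZ.
- by apply: SX; exact: S_semigroup.
Qed.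

Lemma common_kernel_trivial (v : 'cV[R]_d) (B : 'M[R]_d) : S B -> B != 0 ->
  (forall A, S A -> A *m v = 0) -> v = 0.
Proof.
move=> SB B0.
have [||A u SA h A' SA'|+ h|+ _] := @irreducible_dichotomy (fun u => forall A, S A -> A *m u = 0).
- by move=> A _; rewrite mulmx0.
- by move=> a u w hu hw A SA; rewrite mulmxDr -scalemxAr hu // hw // scaler0 addr0.
- by rewrite mulmxA h //; exact: S_semigroup.
- by move=> /(_ v h).
- move=> h; case/eqP: B0; apply/matrixP => i j.
  by have := h (delta_mx j 0) B SB; rewrite -colE => /colP/(_ i); rewrite !mxE.
Qed.

End Semigroup.

(** In a full-rank factorization of an idempotent the two factors multiply in the other order to the
    identity, so the trace is the rank, and characteristic 0 concludes. *)
Lemma mxtrace_idempotent (R : numFieldType) n (E : 'M[R]_n) :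
  E *m E = E -> \tr E = 0 -> E = 0.
Proof.
move=> EE; rewrite -{1}(mulmx_base E) mxtrace_mulC.
have -> : row_base E *m col_base E = 1%:M.
  have [L hL] := row_fullP (col_base_full E).
  have [N hN] := row_freeP (row_base_free E).
  have : col_base E *m row_base E *m (col_base E *m row_base E) = col_base E *m row_base E.
    by rewrite mulmx_base.
  move: (col_base E) (row_base E) hL hN => U V hL hN.
  move=> /(congr1 (fun M => L *m M *m N)).
  by rewrite /= !mulmxA hL mul1mx -mulmxA hN mulmx1.
by rewrite mxtrace1 => /eqP; rewrite pnatr_eq0 mxrank_eq0 => /eqP.
Qed.

Lemma horner_mx_fixed (R : fieldType) n (c : 'M[R]_n.+1) (v : 'cV[R]_n.+1) p :
  c *m v = v -> horner_mx c p *m v = p.[1] *: v.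
Proof.
move=> cv; elim/poly_ind: p => [|p k IHp]; first by rewrite rmorph0 mul0mx horner0 scale0r.
rewrite rmorphD rmorphM /= horner_mx_X horner_mx_C mulmxDl -mulmxA cv IHp.
by rewrite mul_scalar_mx hornerMXaddC mulr1 scalerDl.
Qed.

(* If c fixes a nonzero vector, the Fitting projection onto the part where c is
   invertible is a nonzero idempotent polynomial in c divisible by c. *)
Lemma trace_fixed_vector (R : numFieldType) n (c : 'M[R]_n.+1) (v : 'cV[R]_n.+1) :
  c *m v = v -> (forall p, \tr (c *m horner_mx c p) = 0) -> v = 0.
Proof.
move=> cv trc; apply/eqP/contraT => v0.
have [m [h hroot eh]] := multiplicity_XsubC (char_poly c) 0.
rewrite subr0 in eh.
have {hroot} h0 : ~~ root h 0.
  by apply: (implyP hroot); rewrite monic_neq0 // char_poly_monic.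
(* The exponent [m.+1] rather than [m] makes [E] divisible by [c] even if [c] is invertible, that
   is, if [m = 0]; idempotence still follows since ['X^(m.+1) * h] is a multiple of the
   characteristic polynomial. *)
have /Bezout_eq1_coprimepP [[u w] /= uw] : coprimep ('X^(m.+1)) h.
  by rewrite coprimep_expl // coprimep_sym -['X]subr0 coprimep_XsubC.
have h1 : h.[1] = 0.
  have := horner_mx_fixed (char_poly c) cv.
  rewrite Cayley_Hamilton mul0mx eh hornerM hornerXn expr1n mulr1 => /esym/eqP.
  by rewrite scaler_eq0 (negPf v0) orbF => /eqP.
pose E := horner_mx c (u * 'X^(m.+1)).
have E1 : E = 1 - horner_mx c (w * h) by rewrite /E -[u * _](addrK (w * h)) uw rmorphB rmorph1.
have Ev : E *m v = v by rewrite E1 mulmxBl mul1mx horner_mx_fixed // hornerM h1 mulr0 scale0r subr0.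
have EE : E *m E = E.
  rewrite -[E *m E]/(E * E) {2}E1 mulrBr mulr1 -rmorphM /=.
  rewrite (_ : u * 'X^(m.+1) * (w * h) = u * w * 'X * char_poly c); last by rewrite eh exprS; move: ('X^m) => y; ring.
  by rewrite rmorphM /= Cayley_Hamilton mulr0 subr0.
have E0 : E = 0.
  apply: mxtrace_idempotent => //; rewrite /E exprS mulrCA rmorphM /= horner_mx_X.
  exact: trc.
by move: v0; rewrite -Ev E0 mul0mx eqxx.
Qed.

(* Otherwise irreducibility gives b in the span of S and v <> 0 with b a v = v. *)
Lemma trace_form_nondegenerate (R : realType) n (S : set 'M[R]_n.+1) X a :
  matrix_semigroup S -> irreducible_family S ->
  (forall x, x \in X -> S x) -> (forall y, S y -> y \in <<X>>%VS) ->
  a \in <<X>>%VS -> (forall B, S B -> \tr (a *m B) = 0) -> a = 0.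
Proof.
move=> Ssem Sirr XS SX aX tra; apply/eqP/contraT => a0.
have mulX := span_semigroup_mul Ssem XS SX.
have {}tra b : b \in <<X>>%VS -> \tr (a *m b) = 0.
  move: b; apply: span_ind => [|k u v hu hv|x /XS]; last exact: tra.
    by rewrite mulmx0 mxtrace0.
  by rewrite mulmxDr -scalemxAr mxtraceD mxtraceZ hu hv mulr0 addr0.
have [j aj] : exists j, col j a != 0.
  apply/existsP; apply: contraNT a0; rewrite negb_exists => /forallP h.
  apply/eqP/matrixP => i j; have := h j; rewrite negbK => /eqP/colP/(_ i).
  by rewrite !mxE.
pose v : 'cV[R]_n.+1 := delta_mx j 0.
have av : a *m v != 0 by rewrite -colE.
have [B SB B0] : exists2 B, S B & B != 0.
  apply: contrapT => h; case/eqP: a0; move: a aX {tra aj av}; apply: span_ind => [//|k u w -> ->|x /XS Sx].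
    by rewrite scaler0 addr0.
  by apply/eqP/contraT => x0; case: h; exists x.
have [||A u SA [b bX ->]|+|] := irreducible_dichotomy Sirr (P := fun u => exists2 b, b \in <<X>>%VS & u = b *m (a *m v)).
- by exists 0; rewrite ?mem0v ?mul0mx.
- move=> k u w [b bX ->] [b' bX' ->]; exists (k *: b + b'); first by rewrite memvD // memvZ.
  by rewrite mulmxDl scalemxAl.
- by exists (A *m b); [apply: mulX => //; exact: SX|rewrite !mulmxA].
- move=> h; case/eqP: av; apply: (common_kernel_trivial Ssem Sirr SB B0) => A SA.
  by apply: h; exists A => //; exact: SX.
move=> /(_ v) [b bX vE].
have : v = 0.
  apply: (@trace_fixed_vector _ _ (b *m a)); first by rewrite -mulmxA -vE.
  (* Cyclicity turns the trace into that of [a] times [p(b a) b]. The trailing factor [b] keeps this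
     product in the span even when [p] has a constant term, although the span need not be known to
     contain the identity. *)
  move=> p; rewrite -mulmxA mxtrace_mulC -mulmxA; apply: tra.
  elim/poly_ind: p => [|p k IHp]; first by rewrite rmorph0 mul0mx mem0v.
  rewrite rmorphD rmorphM /= horner_mx_X horner_mx_C mulmxDl mul_scalar_mx memvD ?memvZ //.
  have -> : horner_mx (b *m a) p * (b *m a) *m b = horner_mx (b *m a) p *m b *m (a *m b).
    by rewrite -[_ * _]/(_ *m _) !mulmxA.
  by apply: (mulX) => //; apply: mulX.
by move=> e; case/eqP: av; rewrite e mulmx0.
Qed.

(** * Boundedness *)

Section Spectrum.
Variable R : realType.

Lemma normc_complex (z : R[i]) : `|z| = (ComplexField.Normc.normc z)%:C%C.
Proof. by case: z. Qed.

(** The supremum is meaningful only for a bounded set; the sum of the moduli of the roots of the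
    characteristic polynomial is an upper bound. *)
Lemma spectrum_le_radius d (A : 'M[R]_d) z : complex_spectrum A z ->
  ComplexField.Normc.normc z <= spectral_radius A.
Proof.
move=> Az; apply: ub_le_sup; last by exists z.
have [s es] := closed_field_poly_normal (char_poly (map_mx (real_complex R) A)).
exists (\sum_(w <- s) ComplexField.Normc.normc w) => _ [w Aw <-].
have ws : w \in s.
  move: Aw; rewrite /complex_spectrum /= eigenvalue_root_char es.
  by rewrite (monicP (char_poly_monic _)) scale1r root_prod_XsubC.
rewrite (big_rem w) //= lerDl sumr_ge0 // => u _.
by rewrite -lecR -normc_complex; exact: normr_ge0.
Qed.

Lemma spectrum_exp d (A : 'M[R]_d.+1) z k : complex_spectrum A z ->
  complex_spectrum (A ^+ k) (z ^+ k).
Proof.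
move=> /eigenvalueP [v ev v0]; apply/eigenvalueP; exists v => //.
elim: k => [|k IHk]; first by rewrite !expr0 map_mx1 mulmx1 scale1r.
by rewrite !exprSr map_mxM mulmxA IHk -scalemxAl ev scalerA.
Qed.

(** All positive powers of [A] lie in [S] and share the radius [r], so [|z|^k <= r] for every
    [k >= 1]. If [|z| > 1], Bernoulli's inequality makes these powers unbounded. *)
Lemma csr_spectrum_le1 d (S : set 'M[R]_d) A z :
  matrix_semigroup S -> constant_spectral_radius S -> S A ->
  complex_spectrum A z -> ComplexField.Normc.normc z <= 1.
Proof.
move=> Ssem [r r0 rS] SA Az.
case: d S A Ssem rS SA Az => [|d] S A Ssem rS SA Az.
  have /eigenvalueP [v _ /eqP []] := Az; apply/rowP => -[]//.
set t := ComplexField.Normc.normc z.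
have ht k : t ^+ k.+1 <= r.
  have Sk : S (A ^+ k.+1).
    by elim: k => [|k IHk]; [rewrite expr1|rewrite exprS; apply: Ssem].
  rewrite -(rS _ Sk); have := spectrum_le_radius (spectrum_exp k.+1 Az).
  apply: le_trans; rewrite -lecR rmorphXn /= -!normc_complex normrX //.
rewrite leNgt; apply/negP => t1.
have bern k : 1 + (t - 1) *+ k <= t ^+ k.
  elim: k => [|k IHk]; first by rewrite expr0 mulr0n addr0.
  have : 0 <= (t - 1) *+ k by rewrite mulrn_wge0 // subr_ge0 ltW.
  rewrite exprS mulrS; move: IHk t1; set a := _ *+ k => IHk t1 a0.
  apply: le_trans (_ : t * (1 + a) <= _); last by rewrite ler_pM2l // (lt_trans ltr01).
  by nra.
have [k hk] : exists k, r < (t - 1) *+ k.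
  have tp : 0 < t - 1 by rewrite subr_gt0.
  exists (Num.truncn (r / (t - 1))).+1.
  by rewrite -mulr_natl -ltr_pdivrMr //; exact: truncnS_gt.
have /lt_le_trans/(_ (bern k.+1)) : r < 1 + (t - 1) *+ k.+1.
  by rewrite mulrS; lra.
by rewrite ltNge ht.
Qed.

(** The zero matrix has radius 0: its spectrum is contained in [{0}], and in dimension 0, where it
    is empty, [sup] takes the default value 0. *)
Lemma csr_neq0 d (S : set 'M[R]_d) A :
  constant_spectral_radius S -> S A -> A != 0.
Proof.
move=> [r /eqP r0 rS] SA; apply/eqP => A0; apply: r0; rewrite -(rS _ SA) A0.
rewrite /spectral_radius.
have : [set ComplexField.Normc.normc z | z in complex_spectrum (0 : 'M[R]_d)] `<=` [set 0].
  move=> _ [z /eigenvalueP [v + v0] <-] /=; rewrite map_mx0 mulmx0 => /esym/eqP.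
  by rewrite scaler_eq0 (negPf v0) orbF => /eqP ->; exact: ComplexField.Normc.normc0.
by move=> /subset_set1 [->|->]; rewrite ?sup0 ?sup1.
Qed.

(** The trace is the sum of the [d] complex roots of the characteristic polynomial, counted with
    multiplicity. *)
Lemma mxtrace_le d (A : 'M[R]_d) :
  (forall z, complex_spectrum A z -> ComplexField.Normc.normc z <= 1) -> `|\tr A| <= d%:R.
Proof.
case: d A => [|d] A hA; first by rewrite /mxtrace big_ord0 normr0.
pose B := map_mx (real_complex R) A.
have [s es] := closed_field_poly_normal (char_poly B).
rewrite (monicP (char_poly_monic _)) scale1r in es.
have ss : size s = d.+1.
  by apply: succn_inj; rewrite -(size_char_poly B) es size_prod_XsubC.
have /oppr_inj e : - \sum_(z <- s) z = - \tr B.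
  by rewrite -char_poly_trace // es -coefPn_prod_XsubC ss.
have hs z : z \in s -> `|z| <= 1.
  move=> zs; rewrite normc_complex -[1]/(1%:C%C) lecR; apply: hA.
  by rewrite /complex_spectrum /= eigenvalue_root_char -/B es root_prod_XsubC.
rewrite -lecR.
have -> : (`|\tr A|)%:C%C = `|\tr B|.
  by rewrite /B trace_map_mx normc_complex /= expr0n addr0 sqrtr_sqr.
rewrite -e; apply: le_trans (ler_norm_sum _ _ _) _.
rewrite rmorph_nat -ss big_seq; apply: le_trans (ler_sum _ (fun z zs => hs z zs)) _.
by rewrite -big_seq big_const_seq count_predT iter_addr addr0.
Qed.

(** Choose a basis [x k] of the span of [S] inside [S]. Its Gram matrix [G] for the trace form is
    invertible by nondegeneracy, and [G] sends the coordinates of [A] to the numbers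
    [\tr (x k *m A)], which are bounded because [x k *m A] is in [S]. *)
Lemma csr_bounded d (S : set 'M[R]_d) : matrix_semigroup S -> irreducible_family S ->
  constant_spectral_radius S ->
  exists K, forall A i j, S A -> `|A i j| <= K.
Proof.
case: d S => [|d] S Ssem Sirr Scsr; first by exists 0 => A [].
have trS A : S A -> `|\tr A| <= d.+1%:R.
  by move=> SA; apply: mxtrace_le => z; exact: (csr_spectrum_le1 Ssem Scsr SA).
have [X [fX XS SX]] := free_family S.
pose N := size X; pose x k := (X`_k : 'M[R]_d.+1).
have Sx (k : 'I_N) : S (x k) by apply: XS; rewrite mem_nth.
pose G := \matrix_(k < N, l < N) \tr (x k *m x l).
have uG : G \in unitmx.
  rewrite -row_free_unit -kermx_eq0; apply/rowV0P => v /sub_kermxP vG.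
  pose a : 'M[R]_d.+1 := \sum_(k < N) v 0 k *: x k.
  have aX : a \in <<X>>%VS.
    by apply: memv_suml => k _; apply: memvZ; apply: SX; exact: Sx.
  have a0 : a = 0.
    apply: (trace_form_nondegenerate Ssem Sirr XS SX aX) => B /SX.
    move: B; apply: span_ind => [|c u w hu hw|_ /(nthP 0) [l lN <-]].
    - by rewrite mulmx0 mxtrace0.
    - by rewrite mulmxDr -scalemxAr mxtraceD mxtraceZ hu hw mulr0 addr0.
    rewrite /a mulmx_suml raddf_sum /=.
    move/rowP: vG => /(_ (Ordinal lN)); rewrite !mxE => vGl; rewrite -[RHS]vGl.
    by apply: eq_bigr => k _; rewrite !mxE -scalemxAl mxtraceZ.
  apply/rowP => k; rewrite mxE; have /freeP fX' : free (in_tuple X) by [].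
  exact: (fX' (v 0)).
have [K hK] : exists K : 'I_N -> R, forall A l, S A -> `|coord (in_tuple X) l A| <= K l.
  exists (fun l => \sum_k `|invmx G l k| * d.+1%:R) => A l SA.
  have -> : coord (in_tuple X) l A = \sum_k invmx G l k * \tr (x k *m A).
    pose c : 'cV[R]_N := \col_k coord (in_tuple X) k A.
    have -> : coord (in_tuple X) l A = (invmx G *m (G *m c)) l 0 by rewrite mulKmx // mxE.
    rewrite mxE; apply: eq_bigr => k _; congr (_ * _); rewrite mxE.
    rewrite [in RHS](coord_span (X := in_tuple X) (SX _ SA)) mulmx_sumr raddf_sum /=.
    by apply: eq_bigr => i _; rewrite !mxE -scalemxAr mxtraceZ mulrC.
  apply: le_trans (ler_norm_sum _ _ _) (ler_sum _ _) => k _.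
  by rewrite normrM ler_wpM2l // trS //; apply: Ssem.
exists (\sum_i \sum_j \sum_l K l * `|x l i j|) => A i j SA.
have K0 l : 0 <= K l by exact: le_trans (hK _ l SA).
have T0 i' j' : 0 <= \sum_l K l * `|x l i' j'| by rewrite sumr_ge0 // => l _; rewrite mulr_ge0.
apply: (@le_trans _ _ (\sum_l K l * `|x l i j|)).
  rewrite (coord_span (X := in_tuple X) (SX _ SA)) summxE.
  apply: le_trans (ler_norm_sum _ _ _) (ler_sum _ _) => l _.
  by rewrite mxE normrM ler_wpM2r // hK.
rewrite (bigD1 i) //= (bigD1 j) //= -addrA lerDl addr_ge0 ?sumr_ge0 // => i' _.
by rewrite sumr_ge0.
Qed.
End Spectrum.
(** * Invariant forms *)

Section Stages.
Variables (R : realType) (d : nat) (S : set 'M[R]_d).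
Hypothesis S_semigroup : matrix_semigroup S.

Lemma orbit_quadric : compact S -> S !=set0 -> (forall A, S A -> A != 0) ->
  exists (p : 'M[R]_d) (e : 'cV[R]_d), psd p /\ forall B, S B -> qform p (B *m e) = 1.
Proof.
move=> S_compact [A1 SA1] S0.
have [A0 SA0 A0min] : exists2 A0, S A0 & forall B, S B -> (\rank A0 <= \rank B)%N.
  pose P n := `[< exists2 A, S A & \rank A = n >].
  have exP : exists n, P n by exists (\rank A1); apply/asboolP; exists A1.
  case: (ex_minnP exP) => _ /asboolP [A0 SA0 <-] min; exists A0 => // B SB.
  by apply: min; apply/asboolP; exists B.
pose r := \rank A0.
pose U : 'M[R]_(d, r) := col_base A0; pose V : 'M[R]_(r, d) := row_base A0.
have UV : U *m V = A0 by exact: mulmx_base.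
(* Minimality of the rank makes the compressions g B a semigroup of invertible
   matrices. *)
pose g B := V *m B *m U.
have g_unit B : S B -> g B \in unitmx.
  move=> SB; rewrite -row_free_unit /row_free eqn_leq rank_leq_row /=.
  apply: leq_trans (A0min (A0 *m B *m A0) _) _.
    by apply: S_semigroup => //; exact: S_semigroup.
  rewrite -UV (_ : _ *m _ = U *m g B *m V); last by rewrite /g !mulmxA.
  by apply: leq_trans (mxrankM_maxl _ _) _; exact: mxrankM_maxr.
have S3 B B' : S B -> S B' -> S (B *m A0 *m B').
  by move=> SB SB'; apply: (S_semigroup) => //; exact: S_semigroup.
have gg B B' : g B *m g B' = g (B *m A0 *m B') by rewrite /g -UV !mulmxA.
(* A compression with |det| < 1, multiplied by one of minimal |det|, would
   contradict that minimality. *)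
have g_det B : S B -> 1 <= \det (g B) ^+ 2.
  move=> SB.
  have [||B0] := @compact_EVT_min _ _ (fun B => \det (g B) ^+ 2) S _ S_compact.
  - by exists B.
  - apply: continuous_subspaceT => x.
    apply: (@continuous_comp _ _ _ (fun B => \det (g B)) (fun x => x ^+ 2)); last exact: exprn_continuous.
    apply: (@continuous_comp _ _ _ g (fun M => \det M)); first exact: mulmx_continuous.
    exact: determinant_continuous.
  rewrite inE => SB0 min.
  have det0 : 0 < \det (g B0) ^+ 2.
    by rewrite exprn_even_gt0 //= -unitfE -unitmxE g_unit.
  have := min (B *m A0 *m B0); rewrite inE => /(_ (S3 _ _ SB SB0)).
  by rewrite -gg det_mulmx exprMn ler_pMl.
pose dl i : 'cV[R]_r := delta_mx i 0.
have [b hb] : exists b : 'I_r -> R, forall i B, S B -> qform 1%:M (g B *m dl i) <= b i.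
  suff /choice [b hb] : forall i, exists b, forall B, S B -> qform 1%:M (g B *m dl i) <= b by exists b.
  move=> i; have [||B0 _ max] := @compact_EVT_max _ _ (fun B => qform 1%:M (g B *m dl i)) S _ S_compact.
  - by exists A1.
  - apply: continuous_subspaceT.
    rewrite (_ : (fun _ => _) = fun B => \sum_k (V *m B *m (U *m dl i)) k 0 * (V *m B *m (U *m dl i)) k 0).
      apply: continuous_big => [|k _]; first exact: add_continuous.
      have ck : continuous (fun B : 'M[R]_d => (V *m B *m (U *m dl i)) k 0).
        move=> B; apply: (@continuous_comp _ _ _ (fun B => V *m B *m (U *m dl i)) (fun y => y k 0)).
          exact: mulmx_continuous.
        exact: coord_continuous.
      exact: continuous_mulr.
    apply/funext => B; rewrite qform1; apply: eq_bigr => k _.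
    by rewrite /g -mulmxA expr2.
  by exists (qform 1%:M (g B0 *m dl i)) => B SB; apply: max; rewrite inE.
have b0 i : 0 <= b i by exact: le_trans (qform1_ge0 _) (hb i _ SA1).
(* The bounds on basis vectors give compactness; those on their orbits make [C] stable under
   congruence by each [g B]. The constant [1 + b i] is large enough for the identity form to satisfy
   both. *)
pose C := [set q : 'M[R]_r | [/\ psd q, forall i, qform q (dl i) <= 1 + b i &
  forall i B, S B -> qform q (g B *m dl i) <= 1 + b i]].
have psdC q : C q -> psd q by case.
have C_closed : closed C.
  rewrite (_ : C = [set q | psd q] `&` \bigcap_i [set q | qform q (dl i) <= 1 + b i] `&`
     \bigcap_i \bigcap_(B in S) [set q | qform q (g B *m dl i) <= 1 + b i]).
    apply: closedI; [apply: closedI|]; first exact: psd_closed.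
      apply: closed_bigI => i _; apply: (@closed_preimage _ _ _ [set y | y <= 1 + b i]); last exact: closed_le.
      exact: qform_continuous.
    apply: closed_bigI => i _; apply: closed_bigI => B _.
    apply: (@closed_preimage _ _ _ [set y | y <= 1 + b i]); last exact: closed_le.
    exact: qform_continuous.
  apply/seteqP; split=> q.
    by move=> [pq h1 h2]; split; [split => //|]; [move=> i _; exact: h1|move=> i _ B SB; exact: h2].
  by move=> [[pq h1] h2]; split=> // [i|i B SB]; [exact: h1|exact: h2].
have C_compact : compact C.
  by apply: psd_compact => // i; exists (1 + b i) => q [_ qi _]; exact: qi.
have [||q0 [Cq0 pd0 _ uniq]] := det_maximizer C_compact psdC.
- move=> p q [pp p1 p2] [pq q1 q2].
  have mid x : qform (2^-1 *: (p + q)) x = (qform p x + qform q x) / 2.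
    by rewrite qformZl qformDl mulrC.
  split=> [|i|i B SB]; first by apply: psdZ => //; exact: psdD.
    by rewrite mid; have := p1 i; have := q1 i; lra.
  by rewrite mid; have := p2 i B SB; have := q2 i B SB; lra.
- exists 1%:M; last exact: pd1.
  split=> [|i|i B SB]; first exact/pd_psd/pd1.
    rewrite qform1 (bigD1 i) //= big1 ?mxE ?eqxx ?expr1n ?addr0 ?lerDl //.
    by move=> k ki; rewrite mxE (negPf ki) expr0n.
  by apply: le_trans (hb i B SB) _; rewrite lerDr.
(* Congruence by [g B] keeps [q0] in [C] and, by [g_det], does not decrease its determinant, so
   uniqueness of the maximizer applies. *)
have fix0 B : S B -> (g B)^T *m q0 *m g B = q0.
  move=> SB; apply: uniq.
    case: Cq0 => pq h1 h2; split=> [|i|i B' SB']; first exact: psd_congr.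
      by rewrite qform_congr; exact: h2.
    by rewrite qform_congr mulmxA gg; apply: h2; exact: S3.
  rewrite !det_mulmx det_tr mulrAC -expr2 ler_peMl ?g_det //.
  exact: ltW (pd_det_gt0 pd0).
have r0 : (0 < r)%N by rewrite lt0n mxrank_eq0 S0.
(* Any nonzero [x] would do: with [e = U x], the pulled-back form at [B e] is [q0] at [g B x], which
   equals [q0] at [x]; dividing by this value yields 1. *)
pose x := dl (Ordinal r0).
have c0 : 0 < qform q0 x.
  case: pd0 => _; apply; apply/eqP => /colP/(_ (Ordinal r0))/eqP.
  by rewrite !mxE !eqxx oner_eq0.
exists ((qform q0 x)^-1 *: (V^T *m q0 *m V)), (U *m x); split.
  by apply: psdZ; [rewrite invr_ge0 ltW|apply/psd_congr/pd_psd].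
move=> B SB; rewrite qformZl qform_congr.
rewrite (_ : V *m _ = g B *m x) -?qform_congr ?fix0 //; last by rewrite /g -!mulmxA.
by rewrite mulVf // gt_eqF.
Qed.

Hypothesis S_irr : irreducible_family S.

Lemma invariant_form p e : S !=set0 -> psd p ->
  (forall B, S B -> qform p (B *m e) = 1) ->
  exists2 Q, pd Q & forall M, S M -> M \in unitmx -> M^T *m Q *m M = Q.
Proof.
move=> [A1 SA1] pp pe.
pose C := [set q : 'M[R]_d | psd q /\ forall A, S A -> qform q (A *m e) = 1].
have psdC q : C q -> psd q by case.
have CS q M : C q -> S M -> C (M^T *m q *m M).
  move=> [pq q1] SM; split=> [|A SA]; first exact: psd_congr.
  by rewrite qform_congr mulmxA q1 //; exact: S_semigroup.
have C_closed : closed C.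
  rewrite (_ : C = [set q | psd q] `&` \bigcap_(A in S) [set q | qform q (A *m e) = 1]).
    apply: closedI; first exact: psd_closed.
    apply: closed_bigI => A _.
    apply: (@closed_preimage _ _ _ [set y | y = 1]); last exact: closed_eq.
    exact: qform_continuous.
  by apply/seteqP; split=> q [pq h]; split=> // A; exact: h.
have Ae0 A : S A -> A *m e != 0.
  move=> SA; apply/eqP => h; have := pe A SA.
  by rewrite h /qform mulmx0 mxE => /eqP; rewrite eq_sym oner_eq0.
(* The vectors at which [C] is uniformly bounded form an invariant subspace, and it contains the
   nonzero vector [A1 *m e]. *)
have C_bounded v : exists b, forall q, C q -> qform q v <= b.
  have [||A u SA [b hb]|h|//] := irreducible_dichotomy S_irr
    (P := fun v => exists b, forall q, C q -> qform q v <= b).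
  - by exists 0 => q _; rewrite /qform mulmx0 mxE.
  (* The bound comes from the parallelogram identity [h1], after dropping the nonnegative value at
     [a u - w]. *)
  - move=> a u w [b hb] [b' hb']; exists (2 * (a ^+ 2 * b) + 2 * b') => q Cq.
    have [sq q0] := psdC q Cq.
    have h1 : qform q (a *: u + w) + qform q (a *: u + -1 *: w) =
        2 * (a ^+ 2 * qform q u) + 2 * qform q w.
      have scalE c (N : 'M[R]_1) : (c *: N) 0 0 = c * N 0 0 by rewrite mxE.
      by rewrite !qformDr // !qformZr -scalemxAr scalE !expr2; ring.
    have h2 := q0 (a *: u + -1 *: w).
    have h3 : a ^+ 2 * qform q u <= a ^+ 2 * b by rewrite ler_wpM2l ?sqr_ge0 // hb.
    by have := hb' q Cq; lra.
  - by exists b => q Cq; rewrite -qform_congr; apply: hb; exact: CS.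
  have /h A1e : exists b, forall q, C q -> qform q (A1 *m e) <= b.
    by exists 1 => q [_ ->].
  by have := Ae0 A1 SA1; rewrite A1e eqxx.
have C_compact : compact C by apply: psd_compact.
have C_mid q q' : C q -> C q' -> C (2^-1 *: (q + q')).
  move=> [pq q1] [pq' q1']; split=> [|A SA]; first by apply: psdZ => //; exact: psdD.
  by rewrite qformZl qformDl q1 // q1' //; field.
(* The witness averages [p] with finitely many congruent forms [B^T p B] spanning all of them. A
   vector at which it vanishes is killed by every [p B]; such vectors form an invariant subspace,
   which is not the whole space because [p] is 1 at [A1 *m e]. *)
have C_pd : exists2 q, C q & pd q.
  have [X [_ XP PX]] := free_family [set B^T *m p *m B | B in S].
  have XC x : x \in X -> C x.
    move=> /XP [B SB <-]; split=> [|A SA]; first exact: psd_congr.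
    by rewrite qform_congr mulmxA pe //; exact: S_semigroup.
  pose q1 := (size X).+1%:R^-1 *: (p + \sum_(x <- X) x).
  have q1E v : qform q1 v = (size X).+1%:R^-1 * (qform p v + \sum_(x <- X) qform x v).
    rewrite qformZl qformDl; congr (_ * (_ + _)).
    by rewrite /qform mulmx_sumr mulmx_suml summxE.
  have psd1 : psd q1.
    apply: psdZ; first by rewrite invr_ge0.
    apply: psdD => //; rewrite big_seq; elim/big_ind: _ => [|x y px py|x /XC [] //].
      by split=> [|x]; rewrite ?trmx0 // /qform mulmx0 mul0mx mxE.
    exact: psdD.
  exists q1.
    split=> // A SA; rewrite q1E pe // big_seq (eq_bigr (fun=> 1)) => [|x /XC [_ ->] //].
    by rewrite -big_seq big_const_seq count_predT iter_addr addr0 -mulrS mulVf.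
  case: (psd1) => sq1 q1_ge0; split=> // v v0; rewrite lt_neqAle q1_ge0 andbT eq_sym.
  apply: contra v0; rewrite q1E mulf_eq0 invr_eq0 pnatr_eq0 /=.
  have X_ge0 : 0 <= \sum_(x <- X) qform x v.
    by rewrite big_seq sumr_ge0 // => x /XC [[_ ]].
  rewrite paddr_eq0 //; last by case: pp.
  move=> /andP [_]; rewrite big_seq psumr_eq0; last by move=> x /XC [[_ ]].
  move=> /allP Xv.
  have Xv0 y : y \in <<X>>%VS -> y *m v = 0.
    move: y; apply: span_ind => [|a u w hu hw|x xX]; first by rewrite mul0mx.
      by rewrite mulmxDl -scalemxAl hu hw scaler0 addr0.
    apply: psd_ker; first by case: (XC x xX).
    by apply/eqP; have := Xv x xX; rewrite xX.
  have [||A u SA hu B SB|h|h] := irreducible_dichotomy S_irr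
    (P := fun v => forall B, S B -> p *m (B *m v) = 0).
  - by move=> B _; rewrite !mulmx0.
  - by move=> a u w hu hw B SB; rewrite !mulmxDr -!scalemxAr hu // hw // scaler0 addr0.
  - by rewrite (mulmxA B) hu //; exact: S_semigroup.
  - apply/eqP/h => B SB; apply: psd_ker => //; rewrite -qform_congr.
    by rewrite /qform -mulmxA Xv0 ?mulmx0 ?mxE //; apply: PX; exists B.
  - have := pe A1 SA1; rewrite /qform -mulmxA h // mulmx0 mxE => /eqP.
    by rewrite eq_sym oner_eq0.
have [q0 [Cq0 pd0 max uniq]] := det_maximizer C_compact psdC C_mid C_pd.
exists q0 => // M SM uM; apply: uniq; first exact: CS.
(* C is also stable under M^-1: the span of the A e (A e)^T, on which all forms
   of C agree, is mapped into, hence onto, itself by l |-> M l M^T. *)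
have [q' Cq' eq'] : exists2 q', C q' & q0 = M^T *m q' *m M.
  pose q' := (invmx M)^T *m q0 *m invmx M.
  exists q'; last by rewrite /q' !mulmxA -trmx_mul mulVmx // trmx1 mul1mx mulmxKV.
  split=> [|A SA]; first exact/psd_congr/psdC.
  have [X [_ XP PX]] := free_family [set (B *m e) *m (B *m e)^T | B in S].
  pose f : 'End('M[R]_d) := linfun (mulmxr M^T \o mulmx M).
  have fE l : f l = M *m l *m M^T by rewrite lfunE.
  have fX : (f @: <<X>>)%VS = <<X>>%VS.
    apply/eqP; rewrite eqEdim limg_dim_eq.
      rewrite leqnn andbT; apply/subvP => _ /memv_imgP [l lX ->].
      move: l lX; apply: span_ind => [|a u w hu hw|x /XP [B SB <-]].
      - by rewrite linear0 mem0v.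
      - by rewrite linearP memvD // memvZ.
      apply: PX; exists (M *m B); first exact: S_semigroup.
      by rewrite fE !trmx_mul !mulmxA.
    apply/eqP; rewrite -subv0; apply/subvP => l; rewrite memv_cap memv_ker memv0 fE => /andP [_ /eqP h].
    have uMT : M^T \in unitmx by rewrite unitmx_tr.
    by rewrite -(mulKmx uM l) -(mulmxK uMT (M *m l)) h mul0mx mulmx0.
  (* On the generators both sides are values of [q0] on the orbit of [e], hence 1. *)
  have fq l : l \in <<X>>%VS -> \tr (q0 *m f l) = \tr (q0 *m l).
    move: l; apply: span_ind => [|a u w hu hw|_ /XP [B SB <-]]; first by rewrite linear0.
      by rewrite linearP !mulmxDr -!scalemxAr !mxtraceD !mxtraceZ hu hw.
    have [_ q01] := Cq0.
    rewrite -qform_tr q01 // fE (_ : _ *m M^T = (M *m B *m e) *m (M *m B *m e)^T).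
      by rewrite -qform_tr q01 //; exact: S_semigroup.
    by rewrite !trmx_mul !mulmxA.
  have : (A *m e) *m (A *m e)^T \in <<X>>%VS by apply: PX; exists A.
  (* Here [l] is [y y^T] for [y = M^-1 A e], so [\tr (q0 *m l)] is the value of [q'] at [A e]. *)
  rewrite -fX => /memv_imgP [l lX el].
  have [_ q01] := Cq0.
  have : \tr (q0 *m l) = 1 by rewrite -fq // -el -qform_tr q01.
  rewrite qform_congr qform_tr trmx_mul => <-; congr (\tr (_ *m _)).
  move: (A *m e) el => y el.
  rewrite -!mulmxA (mulmxA y) el fE trmx_inv !mulmxA mulVmx // mul1mx.
  by rewrite mulmxK // unitmx_tr.
have h := max q' Cq'.
(* Maximality at [q'] gives [\det q0 = \det M ^+ 2 * \det q' <= \det M ^+ 2 * \det q0]. *)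
have dM : 1 <= \det M ^+ 2.
  rewrite -(ler_pM2r (pd_det_gt0 pd0)) mul1r {1}eq' !det_mulmx det_tr mulrAC -expr2.
  by rewrite ler_wpM2l ?sqr_ge0.
by rewrite !det_mulmx det_tr mulrAC -expr2 ler_peMl // ltW // pd_det_gt0.
Qed.
End Stages.

Theorem theorem2 (R : realType) (d : nat) (S : set 'M[R]_d)
    (S_semigroup : matrix_semigroup S)
    (S_closed : closed S)
    (S_irreducible : irreducible_family S)
    (S_csr : constant_spectral_radius S) :
  exists2 T : 'M[R]_d, T \in unitmx &
    forall A : 'M[R]_d, S A -> A \in unitmx ->
      orthogonal_group (invmx T *m A *m T).
Proof.
have [S0|S_ex] := pselect (S = set0).
  by exists 1%:M; [exact: unitmx1|rewrite S0 => A []].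
move/eqP/set0P in S_ex.
have [K hK] := csr_bounded S_semigroup S_irreducible S_csr.
have S_compact : compact S by apply: mx_compact S_closed => M i j; exact: hK.
have S_neq0 A : S A -> A != 0 by exact: csr_neq0.
have [p [e [pp pe]]] := orbit_quadric S_semigroup S_compact S_ex S_neq0.
have [Q pdQ fixQ] := invariant_form S_semigroup S_irreducible S_ex pp pe.
have [T uT eT] := pd_cholesky pdQ.
exists T => // A SA uA; rewrite /orthogonal_group /=.
have uTT : T^T \in unitmx by rewrite unitmx_tr.
(* With this, the Gram matrix of [T^-1 A T] is [T^T (A^T Q A) T = T^T Q T = 1]. *)
have eQ : Q = (invmx T)^T *m invmx T.
  by rewrite trmx_inv; apply: (can_inj (mulKmx uTT)); apply: (can_inj (mulmxK uT));
    rewrite eT mulmxA mulmxV // mul1mx mulVmx.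
rewrite !trmx_mul -eT -[in RHS](fixQ A) // [in RHS]eQ.
by rewrite !mulmxA.
Qed.
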